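(* Let $P,Q\in\mathcal{L}(n)$ with $P\geq Q$. Then there exists a coordinatization of $Q$ such that a coordinatization of $P$ can be obtained from it via a deformation of exponents. That is, there are a coordinatization $\mathcal{M}$ of $Q$, with generators $m_i=x_Q(a_i)$ ($1\le i\le n$) of its monomial ideal $M_{Q,\mathcal{M}}$, a deformation $\{\epsilon_1,\dots,\epsilon_n\}$ of $(m_1,\dots,m_n)$, and a coordinatization $\mathcal{M}'$ of $P$ such that for each $i$ the generator $x_P(a_i)$ of $M_{P,\mathcal{M}'}$ is the monomial whose exponent vector is the exponent vector of $m_i$ plus $\epsilon_i$.
   Context: A finite atomic lattice is a finite lattice (with minimum $\hat 0$, maximum $\hat 1$) in which every element other than $\hat 0$ is a join of atoms, an atom being an element covering $\hat 0$. $\mathcal{L}(n)$ is the set of all finite atomic lattices with $n$ ordered atoms $a_1,\dots,a_n$ (up to isomorphism respecting the ordering of the atoms), partially ordered by: $Q\leq P$ if and only if there is a join-preserving map $P\to Q$ which is a bijection on atoms (sending $a_i$ to $a_i$). For a lattice $P$ and $x\in P$ put $\lceil x\rceil=\{a\in P : x\le a\}$ and $\lceil x\rceil^c=P\setminus\lceil x\rceil$. A labeling of $P$ is a family $\mathcal{M}=\{m_p\}_{p\in P}$ of monomials in a polynomial ring in finitely many variables over a field ($m_p=1$ meaning $p$ is unlabeled). $M_{P,\mathcal{M}}$ is the monomial ideal generated by the monomials $x_P(a)=\prod_{p\in\lceil a\rceil^c}m_p$ for the atoms $a$ of $P$. The LCM lattice of a monomial ideal is the set of least common multiples of all subsets of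 its minimal monomial generators (with $1$ the lcm of the empty set), ordered by divisibility. The labeling $\mathcal{M}$ is a coordinatization of $P$ if the LCM lattice of $M_{P,\mathcal{M}}$ is isomorphic to $P$. Deformation of exponents: let $M=(m_1,\dots,m_t)$ be a monomial ideal in a polynomial ring in $N$ variables and let $m_{is}$ denote the exponent of the variable $x_s$ in $m_i$. A deformation of $M$ is a choice of vectors $\epsilon_1,\dots,\epsilon_t\in\mathbb{R}^N$ such that for all $i,j,s$: $m_{is}<m_{js}$ implies $m_{is}+\epsilon_{is}<m_{js}+\epsilon_{js}$, and $m_{is}=0$ implies $\epsilon_{is}=0$. The deformed ideal $M_\epsilon$ is generated by the (formal) monomials with exponent vectors $(m_{is}+\epsilon_{is})_s$, $1\le i\le t$. *)

(* Defs.v *)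
From mathcomp Require Import all_boot all_order all_algebra finmap.
From mathcomp Require Import reals.
From mathcomp Require Import mpoly.

Set Implicit Arguments.
Unset Strict Implicit.
Unset Printing Implicit Defensive.

Import Order.TTheory GRing.Theory Num.Theory.

Local Open Scope fset_scope.
Local Open Scope ring_scope.

Section Lattices.
Context {disp : Order.disp_t} {L : finTBLatticeType disp}.

Definition is_atom (x : L) : bool :=
  (\bot < x)%O && [forall y : L, ~~ ((\bot < y)%O && (y < x)%O)].

Definition atomic : Prop :=
  forall x : L, x != \bot%O ->
  exists2 A : {set L}, {subset A <= is_atom} & x = (\join_(a in A) a)%O.

(* The pair (L, a) represents a member of L(n): a i is the (i+1)-st atom. *)
Definition ordered_atomic (n : nat) (a : 'I_n -> L) : Prop :=
  [/\ atomic, injective a & forall x : L, is_atom x <-> exists i, x = a i].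
End Lattices.

Definition join_preserving dP dQ (P : finTBLatticeType dP)
    (Q : finTBLatticeType dQ) (f : P -> Q) : Prop :=
  forall x y : P, f (Order.join x y) = Order.join (f x) (f y).

(* P >= Q in L(n).  Since aP and aQ enumerate the atoms injectively, a map
   sending aP i to aQ i is a bijection on atoms. *)
Definition atomic_ge dP dQ (P : finTBLatticeType dP) (Q : finTBLatticeType dQ)
    n (aP : 'I_n -> P) (aQ : 'I_n -> Q) : Prop :=
  exists2 f : P -> Q, join_preserving f & forall i, f (aP i) = aQ i.

(* Monomials in N variables are exponent vectors 'X_{1..N}: the product of
   monomials is +%MM, divisibility is (_ <= _)%MM, and the monomial 1 is 0%MM. *)
Section MonomialIdeals.
Context {k : fieldType} {N : nat}.

Definition monomial_ideal (G : {fset 'X_{1..N}}) (f : {mpoly k[N]}) : Prop :=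
  exists c : 'X_{1..N} -> {mpoly k[N]}, f = \sum_(m <- G) c m * 'X_[m].

Definition generates (G : {fset 'X_{1..N}}) (I : {mpoly k[N]} -> Prop) : Prop :=
  forall f, I f <-> monomial_ideal G f.

Definition minimal_generators (I : {mpoly k[N]} -> Prop)
    (G : {fset 'X_{1..N}}) : Prop :=
  generates G I /\ forall G' : {fset 'X_{1..N}}, G' `<` G -> ~ generates G' I.

Definition lcm_monomials (S : {fset 'X_{1..N}}) : 'X_{1..N} :=
  \big[@mlcm N/0%MM]_(m <- S) m.

Definition in_lcm_lattice (I : {mpoly k[N]} -> Prop) (m : 'X_{1..N}) : Prop :=
  exists G, minimal_generators I G /\
  exists2 S : {fset 'X_{1..N}}, S `<=` G & m = lcm_monomials S.
End MonomialIdeals.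

Section Labelings.
Context {disp : Order.disp_t} {L : finTBLatticeType disp} {N : nat}.

Definition label_monomial (lab : L -> 'X_{1..N}) (a : L) : 'X_{1..N} :=
  \big[@mnm_add N/0%MM]_(p : L | ~~ (a <= p)%O) lab p.

Definition labeling_ideal (k : fieldType) (lab : L -> 'X_{1..N}) :
    {mpoly k[N]} -> Prop :=
  monomial_ideal [fset label_monomial lab a | a in L & is_atom a].

(* An order isomorphism between lattices is a lattice isomorphism. *)
Definition coordinatization (k : fieldType) (lab : L -> 'X_{1..N}) : Prop :=
  exists phi : L -> 'X_{1..N},
    (forall m, in_lcm_lattice (labeling_ideal (k := k) lab) m
               <-> exists p, m = phi p) /\
    (forall p q : L, (phi p <= phi q)%MM = (p <= q)%O).
End Labelings.

Definition deformation (R : realType) (t N : nat) (m : 'I_t -> 'X_{1..N})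
    (eps : 'I_t -> 'rV[R]_N) : Prop :=
  (forall (i j : 'I_t) (s : 'I_N), (m i s < m j s)%N ->
     (m i s)%:R + eps i 0 s < (m j s)%:R + eps j 0 s) /\
  (forall (i : 'I_t) (s : 'I_N), m i s = 0%N -> eps i 0 s = 0).

(* Main.v *)
Require Import Defs.
From mathcomp Require Import all_boot all_order all_algebra finmap.
From mathcomp Require Import reals.
From mathcomp Require Import mpoly.

Set Implicit Arguments.
Unset Strict Implicit.
Unset Printing Implicit Defensive.

Import Order.TTheory GRing.Theory Num.Theory.

Local Open Scope fset_scope.
Local Open Scope ring_scope.

(** A join-preserving map P -> Q matching the atoms says that every atom set of
    an element of Q is also the atom set of an element of P; sending q to the
    join of the atoms of P numbered like the atoms below q gives an injection
    g : Q -> P with aP i <= g q iff aQ i <= q ([lift_atoms_le]).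

    Take one variable x_p for each p in P.  In both lattices the bottom is
    labeled by the product of all the variables; moreover p in P carries x_p,
    and q in Q carries x_(g q).  Atoms are never below the bottom, so each
    generator is divisible by every variable.  At x_p the generator of aP i
    has exponent 1 if aP i <= p and 2 otherwise; the generator of aQ i has the
    same exponent if p is in the image of g, and exponent 1 if it is not.
    Going from Q to P thus only breaks ties between equal, nonzero exponents,
    which is a deformation.

    That both labelings are coordinatizations is one statement
    ([coordinatization_twostep]): when every lattice element y owns a private
    variable v y, the monomial with exponent (x != bottom) + (x not below y)
    at v y determines x, and the map [lcm_exponent] from x to this monomial
    turns joins into least common multiples because x not below y forces
    x != bottom.  On atoms it gives the generators, so its image is the LCM
    lattice. *)

(** * Monomial ideals generated by an antichain *)

Section AntichainGenerators.
Context {k : fieldType} {N : nat}.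
Implicit Types (G S : {fset 'X_{1..N}}) (m : 'X_{1..N}).

Lemma mem_monomial_ideal G m :
  m \in G -> monomial_ideal (k := k) G 'X_[m].
Proof.
move=> mG; exists (fun m' => (m' == m)%:R).
rewrite (big_fsetD1 m mG) /= eqxx mul1r big1_fset ?addr0 // => m'.
by rewrite !inE => /andP[/negbTE-> _] _; rewrite mul0r.
Qed.

Lemma monomial_ideal_dvd G m :
  monomial_ideal (k := k) G 'X_[m] -> exists2 g, g \in G & (g <= m)%MM.
Proof.
move=> [c Em].
have : ('X_[m] : {mpoly k[N]})@_m != 0 by rewrite mcoeffX eqxx oner_eq0.
rewrite Em raddf_sum /= => nz.
have /hasP[g gG /andP[_ nzg]] :
    has (fun g => true && ((c g * 'X_[g])@_m != 0)) G.
  apply: contraNT nz => /hasPn z; rewrite big_seq big1 // => g gG.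
  by have := z g gG => /=; rewrite negbK => /eqP.
exists g => //; move: nzg; rewrite -mcoeff_msupp (perm_mem (msuppMX _ _)).
by case/mapP=> m' _ ->; rewrite lem_addr.
Qed.

(** A generator from an antichain G is divisible by some element of any other
    generating set G', which is in turn divisible by an element of G; the
    antichain condition closes the loop. *)
Lemma antichain_sub_generating G G' :
  {in G &, forall m m', (m <= m')%MM -> m = m'} ->
  generates G' (monomial_ideal (k := k) G) -> G `<=` G'.
Proof.
move=> acG genG'; apply/fsubsetP => m mG.
have /genG' /monomial_ideal_dvd [g' g'G' le_g'm] := mem_monomial_ideal mG.
have /genG' /monomial_ideal_dvd [g gG le_gg'] := mem_monomial_ideal g'G'.
have Egm : g = m by apply: acG => //; apply: lepm_trans le_g'm.
suff -> : m = g' by [].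
apply/mnmP => i; apply/eqP; rewrite eqn_leq.
by rewrite (mnm_lepP le_g'm i) -Egm (mnm_lepP le_gg' i).
Qed.

Lemma minimal_generators_antichain G G' :
  {in G &, forall m m', (m <= m')%MM -> m = m'} ->
  minimal_generators (monomial_ideal (k := k) G) G' <-> G' = G.
Proof.
move=> acG; split=> [[genG' minG']|->]; last first.
  split=> // G'' ltG gen.
  by move: ltG; rewrite fproperE (antichain_sub_generating acG gen) andbF.
have sGG' := antichain_sub_generating acG genG'.
apply/eqP/negPn/negP => neq; apply: (minG' G) => //.
by rewrite fproperEneq sGG' eq_sym neq.
Qed.

End AntichainGenerators.

(** * Joins of atoms *)

Section Atoms.
Context {disp : Order.disp_t} {L : finTBLatticeType disp}.
Implicit Types (a b x y : L).

Lemma atom_gt0 a : is_atom a -> (\bot < a)%O.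
Proof. by case/andP. Qed.

Lemma atom_le_eq a b : is_atom a -> is_atom b -> (a <= b)%O -> a = b.
Proof.
move=> /atom_gt0 a0 /andP[_ /forallP/(_ a)]; rewrite a0 /=.
by rewrite le_eqVlt => /negbTE-> /orP[/eqP|].
Qed.

Lemma atomic_joinE : atomic (L := L) ->
  forall x, x = (\join_(a in [set a | is_atom a && (a <= x)%O]) a)%O.
Proof.
move=> atL x; apply: le_anti; apply/andP; split; last first.
  by apply/joinsP => a; rewrite inE => /andP[].
have [->|/atL [A Aat Ex]] := eqVneq x \bot%O; first exact: le0x.
rewrite {1}Ex; apply/joinsP => a aA; apply: joins_sup.
by rewrite inE; apply/andP; split; [exact: Aat | rewrite Ex; exact: joins_sup].
Qed.

Lemma atomic_le : atomic (L := L) ->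
  forall x y, (forall a, is_atom a -> (a <= x)%O -> (a <= y)%O) -> (x <= y)%O.
Proof.
move=> atL x y le_xy; rewrite [x]atomic_joinE //; apply/joinsP => a.
by rewrite inE => /andP[]; apply: le_xy.
Qed.

End Atoms.

(** * Labelings with a private variable for every element *)

Section TwoStep.
Context {disp : Order.disp_t} {L : finTBLatticeType disp} {N : nat}.
Variable v : L -> 'I_N.
Implicit Types (a p x y : L).

Definition twostep_labeling x : 'X_{1..N} :=
  [multinom ((v x == s) + (x == \bot%O))%N | s < N].

Definition lcm_exponent x : 'X_{1..N} :=
  [multinom ((x != \bot%O) + [exists y, (v y == s) && ~~ (x <= y)%O])%N | s < N].

Lemma lcm_exponentE x s :
  lcm_exponent x s
  = ((x != \bot%O) + [exists y, (v y == s) && ~~ (x <= y)%O])%N.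
Proof. exact: mnmE. Qed.

Lemma lcm_exponent_bot : lcm_exponent \bot%O = 0%MM.
Proof.
apply/mnmP => s; rewrite lcm_exponentE mnm0E eqxx.
by case: existsP => // -[y]; rewrite le0x andbF.
Qed.

Lemma lcm_exponent_join x y :
  lcm_exponent (Order.join x y) = mlcm (lcm_exponent x) (lcm_exponent y).
Proof.
apply/mnmP => s; rewrite [RHS]mnmE !lcm_exponentE.
have -> : (Order.join x y != \bot%O) = (x != \bot%O) || (y != \bot%O).
  by rewrite join_eq0 negb_and.
have -> : [exists z, (v z == s) && ~~ (Order.join x y <= z)%O]
    = [exists z, (v z == s) && ~~ (x <= z)%O]
      || [exists z, (v z == s) && ~~ (y <= z)%O].
  apply/existsP/orP => [[z]|[]/existsP[z /andP[vz nle]]]; last 2 first.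
  - by exists z; rewrite vz leUx negb_and nle.
  - by exists z; rewrite vz leUx negb_and nle orbT.
  rewrite leUx negb_and => /andP[vz] /orP[] nle; [left|right];
    by apply/existsP; exists z; rewrite vz.
have step w : [exists z, (v z == s) && ~~ (w <= z)%O] -> w != \bot%O.
  by case/existsP=> z /andP[_]; apply: contraNneq => ->; apply: le0x.
move: (step x) (step y).
case: [exists z, _ && ~~ (x <= z)%O] => [/(_ isT) ->|_];
  case: [exists z, _ && ~~ (y <= z)%O] => [/(_ isT) ->|_].
- by [].
- by case: (y != _).
- by case: (x != _).
- by case: (x != _); case: (y != _).
Qed.

Hypothesis v_inj : injective v.

Lemma label_monomial_twostep a :
  is_atom a -> label_monomial twostep_labeling a = lcm_exponent a.
Proof.
move=> /atom_gt0 a0; apply/mnmP => s.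
rewrite mnm_sumE lcm_exponentE -lt0x a0.
under eq_bigr do rewrite mnmE.
rewrite big_split /= addnC; congr addn.
  rewrite (bigD1 \bot%O) /= ?eqxx ?lex0 -?lt0x // big1 // => p /andP[_].
  by move/negbTE->.
case: existsP => [[y /andP[/eqP <- nle]]|nex].
  rewrite (bigD1 y) //= eqxx big1 // => p /andP[_ neq].
  by rewrite (inj_eq v_inj) (negbTE neq).
by apply: big1 => p nle; case: eqP => // vp; case: nex; exists p; rewrite vp eqxx.
Qed.

(** If x is not below y, the exponents at v y are 2 for x and at most 1 for y,
    because v y belongs to no other element. *)
Lemma lcm_exponent_le x y :
  (lcm_exponent x <= lcm_exponent y)%MM = (x <= y)%O.
Proof.
apply/idP/idP => [/mnm_lepP/(_ (v y))|le_xy]; last first.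
  move/join_idPr: le_xy => <-.
  by rewrite lcm_exponent_join lem_mlcml.
rewrite !lcm_exponentE; apply: contraTT => nle.
have -> : [exists z, (v z == v y) && ~~ (x <= z)%O].
  by apply/existsP; exists y; rewrite eqxx.
have -> : x != \bot%O by apply: contraNneq nle => ->; apply: le0x.
case: existsP => [[z]|_]; last by case: (_ != _).
by rewrite (inj_eq v_inj) => /andP[/eqP->]; rewrite lexx.
Qed.

Lemma lcm_of_lcm_exponents (S : {fset 'X_{1..N}}) :
  (forall m, m \in S -> exists x, m = lcm_exponent x) ->
  exists x, lcm_monomials S = lcm_exponent x.
Proof.
move=> imS; rewrite /lcm_monomials big_seq.
apply: (big_ind (fun m => exists x, m = lcm_exponent x)) => //.
  by exists \bot%O; rewrite lcm_exponent_bot.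
by move=> _ _ [x ->] [y ->]; exists (Order.join x y); rewrite lcm_exponent_join.
Qed.

Lemma lcm_monomials_le (S : {fset 'X_{1..N}}) m :
  (lcm_monomials S <= m)%MM <-> (forall s, s \in S -> (s <= m)%MM).
Proof.
have allE : (lcm_monomials S <= m)%MM = all (fun s => (s <= m)%MM) S.
  rewrite /lcm_monomials; elim: (enum_fset S) => [|s r IHr] /=.
    by rewrite big_nil; apply/mnm_lepP => i; rewrite mnm0E.
  by rewrite big_cons lem_mlcm IHr.
by rewrite allE; split => /allP.
Qed.

Lemma coordinatization_twostep (k : fieldType) :
  atomic (L := L) -> coordinatization k twostep_labeling.
Proof.
move=> atL; exists lcm_exponent; split=> [m|]; last exact: lcm_exponent_le.
rewrite /in_lcm_lattice /labeling_ideal.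
set G := [fset _ | _ in _ & _].
have GP m' : reflect (exists2 a, is_atom a & m' = lcm_exponent a) (m' \in G).
  apply: (iffP (imfsetP _ _ _ _)) => -[a]; rewrite ?inE /=.
    by move=> ata ->; exists a; rewrite // label_monomial_twostep.
  by move=> ata ->; exists a; rewrite ?inE //= label_monomial_twostep.
have acG : {in G &, forall m m', (m <= m')%MM -> m = m'}.
  move=> _ _ /GP[a ata ->] /GP[b atb ->].
  by rewrite lcm_exponent_le => /(atom_le_eq ata atb) ->.
split=> [[G' [/(minimal_generators_antichain _ acG) -> [S sSG ->]]]|[p ->]].
  apply: lcm_of_lcm_exponents => m' /(fsubsetP sSG) /GP[a _ ->]; by exists a.
exists G; split; first exact/(minimal_generators_antichain _ acG).
pose S := [fset m in G | (m <= lcm_exponent p)%MM].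
exists S; first by apply/fsubsetP => m'; rewrite !inE => /andP[].
have [r Er] : exists r, lcm_monomials S = lcm_exponent r.
  apply: lcm_of_lcm_exponents => m'; rewrite !inE => /andP[/GP[a _ ->] _].
  by exists a.
rewrite Er; congr lcm_exponent; apply: le_anti; apply/andP; split.
  apply: atomic_le => // a ata le_ap; rewrite -lcm_exponent_le -Er.
  have /lcm_monomials_le := lepm_refl (lcm_monomials S); apply.
  by rewrite !inE lcm_exponent_le le_ap andbT; apply/GP; exists a.
rewrite -lcm_exponent_le -Er; apply/lcm_monomials_le => m'.
by rewrite !inE => /andP[].
Qed.

End TwoStep.

(** * Embedding the smaller lattice by its atom sets *)

Section LiftAtoms.
Context {dP dQ : Order.disp_t} {P : finTBLatticeType dP}.
Context {Q : finTBLatticeType dQ} {n : nat}.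
Variables (aP : 'I_n -> P) (aQ : 'I_n -> Q).

Definition lift_atoms (q : Q) : P := (\join_(i < n | (aQ i <= q)%O) aP i)%O.

(** Why the atom sets of Q are atom sets of P: applying f to the join shows
    that no new atom falls below it.  The case of an empty join is kept apart,
    as f may fail to preserve the bottom when there is only one atom. *)
Lemma lift_atoms_le : (forall i, is_atom (aP i)) -> atomic_ge aP aQ ->
  forall i q, (aP i <= lift_atoms q)%O = (aQ i <= q)%O.
Proof.
move=> atP [f fU faP] i q; apply/idP/idP => [le_i|le_i]; last first.
  exact: joins_sup.
have : lift_atoms q = \bot%O \/ (f (lift_atoms q) <= q)%O.
  apply: (big_ind (fun x => x = \bot%O \/ (f x <= q)%O)); first by left.
    move=> x y [->|fx]; first by rewrite join0x.
    case=> [->|fy]; first by rewrite joinx0; right.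
    by right; rewrite fU leUx fx.
  by move=> j le_j; right; rewrite faP.
case=> [E|]; last first.
  by apply: le_trans; rewrite -faP -(join_idPr le_i) fU leUl.
by move: le_i (atom_gt0 (atP i)); rewrite E lex0 => /eqP->; rewrite ltxx.
Qed.

Lemma lift_atoms_inj : (forall i, is_atom (aP i)) -> ordered_atomic aQ ->
  atomic_ge aP aQ -> injective lift_atoms.
Proof.
move=> atP [atQ _ aQP] ge q q' E.
by apply: le_anti; apply/andP; split; apply: atomic_le => // a /aQP[i ->];
  rewrite -!lift_atoms_le // E.
Qed.

End LiftAtoms.

Unset Implicit Arguments.

Theorem theorem4p2 (k : fieldType) (R : realType) (n : nat)
    (dP dQ : Order.disp_t) (P : finTBLatticeType dP) (Q : finTBLatticeType dQ)
    (aP : 'I_n -> P) (aQ : 'I_n -> Q)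
    (hP : ordered_atomic aP) (hQ : ordered_atomic aQ)
    (hPQ : atomic_ge aP aQ) :
  exists (N : nat) (labQ : Q -> 'X_{1..N}) (labP : P -> 'X_{1..N})
         (eps : 'I_n -> 'rV[R]_N),
    [/\ coordinatization k labQ,
        deformation (fun i => label_monomial labQ (aQ i)) eps,
        coordinatization k labP
      & forall (i : 'I_n) (s : 'I_N),
          (label_monomial labP (aP i) s)%:R
          = (label_monomial labQ (aQ i) s)%:R + eps i 0 s].
Proof.
have [atP _ aPP] := hP; have [atQ _ aQP] := hQ.
have aP_atom i : is_atom (aP i) by apply/aPP; exists i.
have aQ_atom i : is_atom (aQ i) by apply/aQP; exists i.
pose g := lift_atoms aP aQ.
have g_le i q : (aP i <= g q)%O = (aQ i <= q)%O by apply: lift_atoms_le.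
pose vP (p : P) := enum_rank p; pose vQ (q : Q) := vP (g q).
have vP_inj : injective vP by apply: enum_rank_inj.
have vQ_inj : injective vQ.
  by apply: inj_comp vP_inj (lift_atoms_inj aP_atom hQ hPQ).
have mP i s : label_monomial (twostep_labeling vP) (aP i) s
    = (1 + ~~ (aP i <= enum_val s)%O)%N.
  rewrite label_monomial_twostep // lcm_exponentE -lt0x atom_gt0 //.
  congr addn; congr nat_of_bool; apply/existsP/idP => [[p /andP[/eqP<-]]|nle].
    by rewrite enum_rankK.
  by exists (enum_val s); rewrite nle /vP enum_valK eqxx.
have mQ i s : label_monomial (twostep_labeling vQ) (aQ i) s
    = (1 + [exists q, g q == enum_val s] && ~~ (aP i <= enum_val s)%O)%N.
  rewrite label_monomial_twostep // lcm_exponentE -lt0x atom_gt0 //.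
  congr addn; congr nat_of_bool.
  apply/existsP/andP => [[q /andP[/eqP<-]]|[/existsP[q /eqP Eq]]].
    rewrite enum_rankK g_le => ->; split=> //.
    by apply/existsP; exists q.
  by rewrite -Eq g_le => nle; exists q; rewrite nle /vQ Eq /vP enum_valK eqxx.
exists #|P|, (twostep_labeling vQ), (twostep_labeling vP).
exists (fun i => \row_s ((label_monomial (twostep_labeling vP) (aP i) s)%:R
                   - (label_monomial (twostep_labeling vQ) (aQ i) s)%:R)).
split; [exact: coordinatization_twostep| |exact: coordinatization_twostep|];
  last by move=> i s; rewrite mxE subrKC.
split=> [i j s|i s]; last by rewrite mQ.
rewrite !mxE !subrKC ltr_nat !mP !mQ.
by case: [exists _, _]; rewrite ?ltnn.
Qed.
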